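(* There exist absolute constants $c, C > 0$ such that for every integer $H \geq 3$, $$c\sqrt{H/\log H} \leq \kappa(H) \leq C H.$$
   Context: For a subset $A \subseteq \mathbb{Z}$ and a positive integer $h$, the $h$-fold iterated sumset is $hA:=\{a_1+\cdots+a_h : a_1,\ldots,a_h \in A\}$ (repetitions allowed), and $|X|$ denotes the cardinality of a finite set $X$. For a positive integer $H$, $\kappa(H)$ denotes the smallest natural number $k$ such that for each choice of signs $\epsilon_1, \ldots, \epsilon_H \in \{-,+\}$, there are sets $A,B \subseteq \mathbb{Z}$, each of size at most $k$, such that $|hA|-|hB|$ has the same sign as $\epsilon_h$ for each $1 \leq h \leq H$ (that is, $|hA|-|hB|>0$ if $\epsilon_h = +$ and $|hA|-|hB|<0$ if $\epsilon_h=-$). Such a $k$ exists for every $H$. $\log$ is the natural logarithm. *)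

(* Defs.v *)
From mathcomp Require Import all_boot all_order all_algebra finmap.
From mathcomp Require Import all_classical all_reals all_analysis.

Set Implicit Arguments.
Unset Strict Implicit.
Unset Printing Implicit Defensive.

Import Order.TTheory GRing.Theory Num.Theory.
Local Open Scope ring_scope.
Local Open Scope fset_scope.

Definition iter_sumset (h : nat) (A : {fset int}) : {fset int} :=
  [fset \sum_(i < h) fsval (tnth a i) | a in {: h.-tuple A}].

(* [eps h = true] encodes the sign +; only eps 1, ..., eps H matter. *)
Definition realizes_signs (H : nat) (eps : nat -> bool) (A B : {fset int}) :=
  forall h : nat, (1 <= h <= H)%N ->
    let d : int := #|` iter_sumset h A|%:Z - #|` iter_sumset h B|%:Z in
    if eps h then 0 < d else d < 0.

Definition all_signs_realizable (H k : nat) : Prop :=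
  forall eps : nat -> bool, exists A B : {fset int},
    [/\ (#|` A| <= k)%N, (#|` B| <= k)%N & realizes_signs H eps A B].

(* The least k with [all_signs_realizable H k]. The default 0 would only be
   returned if there were no such k; a positive lower bound on [kappa H]
   therefore also asserts that such a k exists. *)
Definition kappa (H : nat) : nat :=
  xget 0%N (fun k : nat => all_signs_realizable H k /\
    forall j : nat, all_signs_realizable H j -> (k <= j)%N).

(* Main.v *)
(**
Upper bound. In Z^3, put the segment {(0,0,0), (0,0,1)} in layer 0, and in layer 1
the boundary of a square of side M together with one arbitrary point (x, l x) in
each column x. The boundary of a square is an additive 2-basis of the doubled
square, so layers g >= 2 of the h-fold sumset do not see l. In layer 1, column x
carries the two intervals of length h started by the boundary, and between them the
point (x, l x) starts a third one, which adds min(h, l x) new elements. Hence the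
size of the h-fold sumset is a quantity independent of l plus the sum of the
min(h, l x), and since min(h, _) has second difference - [h = k] at k, two columns
for each k suffice to prescribe the sign at k. Reading triples in a large base
moves the set to Z; its size is O(M) = O(H).

Lower bound. Write A = {a_1, ..., a_k}. The sizes |hA| for h <= H only depend on
which integer vectors w with entries in [-H, H] satisfy w . a = 0. These w are the
vectors of the box lying in the subspace they span, and that subspace is spanned by
k of them. So there are at most (2H+1)^(k^2) + 1 possible sequences (the + 1 is for
the empty set), while 2^H sign patterns have to be produced by pairs of sequences.
*)
Require Import Defs.
From mathcomp Require Import all_boot all_order all_algebra finmap.
From mathcomp Require Import all_classical all_reals all_analysis.
From mathcomp Require Import zify ring lra.
Set Implicit Arguments.
Unset Strict Implicit.
Unset Printing Implicit Defensive.
Import Order.TTheory GRing.Theory Num.Theory.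
Local Open Scope ring_scope.

(** * Iterated sumsets as sums of lists *)

Lemma iter_sumsetP (h : nat) (A : {fset int}) (z : int) :
  reflect (exists s : seq int, [/\ size s = h, all (mem A) s & z = \sum_(x <- s) x])
    (z \in iter_sumset h A).
Proof.
apply: (iffP idP).
  move=> /imfsetP /= [a _ ->]; exists [seq fsval x | x <- a]; split.
  - by rewrite size_map size_tuple.
  - by apply/allP => _ /mapP [x _ ->]; apply: fsvalP.
  - by rewrite big_map big_tuple.
case=> s [<- sA ->]; apply/imfsetP => /=.
have sP (i : 'I_(size s)) : tnth (in_tuple s) i \in A.
  by move/allP: sA; apply; apply: mem_tnth.
exists [tuple [` sP i]%fset | i < size s] => //.
rewrite (big_tuple _ _ (in_tuple s)) /=.
by apply: eq_bigr => i _; rewrite tnth_mktuple.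
Qed.

Lemma iter_sumset1 (A : {fset int}) : iter_sumset 1 A =i A.
Proof.
move=> z; apply/iter_sumsetP/idP => [[[|x [|? ?]] [//= _]]|zA].
  by rewrite andbT big_seq1 => xA ->.
by exists [:: z]; rewrite big_seq1 /= zA.
Qed.

Lemma iter_sumsetS (h : nat) (A : {fset int}) (z : int) :
  reflect (exists a b, [/\ a \in A, b \in iter_sumset h A & z = a + b])
    (z \in iter_sumset h.+1 A).
Proof.
apply: (iffP (iter_sumsetP _ _ _)).
  case=> -[[]|x s [[sh] /andP [xA sA] ->]] //; exists x, (\sum_(y <- s) y).
  by split; rewrite ?big_cons //; apply/iter_sumsetP; exists s.
case=> a [b [aA /iter_sumsetP [s [sh sA ->]] ->]].
by exists (a :: s); rewrite /= sh aA big_cons.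
Qed.

(** * Upper bound: sets with prescribed signs *)

Section Construction.
Local Open Scope nat_scope.

Definition encode (Q g x y : nat) : nat := y + Q * (x + Q * g).

Lemma radix_inj (Q u u' y y' : nat) :
  y < Q -> y' < Q -> y + Q * u = y' + Q * u' -> y = y' /\ u = u'.
Proof.
move=> ltyQ lty'Q e.
have uu' : u = u'.
  have Q0 : 0 < Q by apply: leq_ltn_trans ltyQ.
  have := congr1 (divn^~ Q) e.
  by rewrite /= ![_ + Q * _]addnC ![Q * _]mulnC !divnMDl // !divn_small // !addn0.
by split=> //; move: e; rewrite uu' => /addIn.
Qed.

(** Base-[Q] digits are unique, so elements can be counted as triples, layer by layer and column by
    column. *)
Lemma card_encode (Q : nat) (P : nat -> nat -> nat -> bool) (X : {fset int}) :
  (forall g x y, P g x y -> [/\ g < Q, x < Q & y < Q]) ->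
  (forall z : int, z \in X <-> exists g x y, P g x y /\ z = encode Q g x y) ->
  #|` X| = \sum_(g < Q) \sum_(x < Q) \sum_(y < Q) P g x y.
Proof.
move=> PQ XP.
pose S := [set t : 'I_Q * 'I_Q * 'I_Q | P t.1.1 t.1.2 t.2].
pose e (t : 'I_Q * 'I_Q * 'I_Q) : int := encode Q t.1.1 t.1.2 t.2.
have -> : #|` X| = #|S|.
  rewrite cardE -(size_map e); apply/perm_size/uniq_perm; first exact: fset_uniq.
    rewrite map_inj_uniq ?enum_uniq // => -[[g x] y] [[g' x'] y'] [].
    move=> /(radix_inj (ltn_ord _) (ltn_ord _)) [/val_inj ->].
    by move=> /(radix_inj (ltn_ord _) (ltn_ord _)) [/val_inj -> /val_inj ->].
  move=> z; apply/idP/mapP => [/XP [g [x [y [Pgxy ->]]]]|[[[g x] y]]].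
    have [gQ xQ yQ] := PQ _ _ _ Pgxy.
    by exists (Ordinal gQ, Ordinal xQ, Ordinal yQ); rewrite // mem_enum inE.
  by rewrite mem_enum inE /= => Pt ->; apply/XP; exists g, x, y.
rewrite -sum1_card big_mkcond /= pair_big pair_big /=.
by apply: eq_bigr => t _; rewrite inE; case: (P _ _ _).
Qed.

(* The triples [(g, x, y)] coding the [h]-fold sumset: layer [g = 0] is a segment,
   layer [g = 1] is the boundary of the square of side [M] together with the graph
   of [l], thickened upwards by that segment, and the layers [g >= 2] are full
   because the boundary of a square added to itself fills the doubled square. *)
Definition cells (M : nat) (l : nat -> nat) (h g x y : nat) : bool :=
  match g with
  | 0 => (x == 0) && (y <= h)
  | 1 => (x <= M) && [|| ((x == 0) || (x == M)) && (y < M + h),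
                        y < h, M <= y < M + h | l x <= y < l x + h]
  | _ => [&& g <= h, x <= g * M & y <= g * M + (h - g)]
  end.

Definition frame (M : nat) (l : nat -> nat) : seq (nat * nat * nat) :=
  [:: (0, 0, 0); (0, 0, 1)] ++
  [seq (1, x, 0) | x <- iota 0 M.+1] ++ [seq (1, x, M) | x <- iota 0 M.+1] ++
  [seq (1, 0, y) | y <- iota 0 M.+1] ++ [seq (1, M, y) | y <- iota 0 M.+1] ++
  [seq (1, x, l x) | x <- iota 0 M.+1].

Lemma mem_frame (M : nat) (l : nat -> nat) (g x y : nat) :
  ((g, x, y) \in frame M l) = cells M l 1 g x y.
Proof.
have graph (f : nat -> nat) : ((g, x, y) \in [seq (1, i, f i) | i <- iota 0 M.+1]) =
    [&& g == 1, x <= M & y == f x].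
  apply/mapP/and3P => [[i + [-> -> ->]]|[/eqP -> xM /eqP ->]].
    by rewrite mem_iota.
  by exists x; rewrite ?mem_iota.
have vert c : ((g, x, y) \in [seq (1, c, i) | i <- iota 0 M.+1]) =
    [&& g == 1, x == c & y <= M].
  apply/mapP/and3P => [[i + [-> -> ->]]|[/eqP -> /eqP -> yM]].
    by rewrite mem_iota.
  by exists y; rewrite ?mem_iota.
rewrite /frame !mem_cat !graph !vert !inE !xpair_eqE.
by case: g {graph vert} => [|[|g]] /=; lia.
Qed.

Lemma size_frame M l : size (frame M l) = 5 * M + 7.
Proof. by rewrite /frame !size_cat !size_map !size_iota /=; lia. Qed.

Definition base_set (Q M : nat) (l : nat -> nat) : {fset int} :=
  [fset Posz (encode Q t.1.1 t.1.2 t.2) | t in frame M l]%fset.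

Lemma card_base_set Q M l : #|` base_set Q M l| <= 5 * M + 7.
Proof.
rewrite -(size_frame M l); apply: leq_trans (leq_imfset_card _ _ _) _.
exact: size_undup.
Qed.

Lemma iter_base_setP Q M l h (z : int) : (forall x, l x <= M) -> 0 < h ->
  z \in iter_sumset h (base_set Q M l) <->
  exists g x y, cells M l h g x y /\ z = encode Q g x y.
Proof.
move=> lM; elim: h z => // -[_|h IH] z _.
  rewrite iter_sumset1; split=> [/imfsetP [[[g x] y] /=]|[g [x [y [c ->]]]]].
    by rewrite mem_frame => c ->; exists g, x, y.
  by apply/imfsetP; exists (g, x, y); rewrite //= mem_frame.
have encD g x y g' x' y' : encode Q g x y + encode Q g' x' y' =
    encode Q (g + g') (x + x') (y + y') by rewrite /encode; ring.
have step : z \in iter_sumset h.+2 (base_set Q M l) <-> exists g x y g' x' y',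
   [/\ cells M l 1 g x y, cells M l h.+1 g' x' y' &
     z = encode Q (g + g') (x + x') (y + y')].
  split=> [/iter_sumsetS [a [b [/imfsetP [[[g x] y] /=] + -> /IH]]]|].
    rewrite mem_frame => c /(_ isT) [g' [x' [y' [c' ->]]]] ->.
    by exists g, x, y, g', x', y'; split; rewrite // -encD PoszD.
  move=> [g [x [y [g' [x' [y' [c c' ->]]]]]]]; apply/iter_sumsetS.
  exists (Posz (encode Q g x y)), (Posz (encode Q g' x' y')); split; last by rewrite -encD PoszD.
    by apply/imfsetP; exists (g, x, y); rewrite //= mem_frame.
  by apply/IH => //; exists g', x', y'.
apply: (iff_trans step); split.
  move=> [g [x [y [g' [x' [y' [c c' ->]]]]]]].
  exists (g + g'), (x + x'), (y + y'); split=> //.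
  have := lM x; have := lM x'; move: c c'.
  case: g => [|[|g]] /=.
  - case: g' => [|[|g']] /=; last lia; first lia.
    by move=> /andP [/eqP -> ?]; rewrite !add0n; lia.
  - case: g' => [|[|g']] /=.
    + by move=> + /andP [/eqP -> ?]; rewrite !addn0; lia.
    + rewrite addn1 /=; lia.
    + rewrite !mulSn; lia.
  - lia.
move=> [g [x [y [c ->]]]].
(* Below the top layer, removing [(0, 0, 0)] or [(0, 0, 1)] leads to a cell of the previous
   sumset. *)
have [gh|gh] := leqP g h.+1.
  have [c0|c0] := boolP (cells M l h.+1 g x y).
    by exists 0, 0, 0, g, x, y.
  have [y0 c1] : 0 < y /\ cells M l h.+1 g x y.-1.
    by move: c c0 gh; case: g => [|[|g]] /=; lia.
  by exists 0, 0, 1, g, x, y.-1; rewrite add1n prednK.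
have {gh} gE : g = h.+2 by move: c gh; case: g => [|[|g]] /=; lia.
move: c; rewrite {}gE /= => /and3P [_ xM yM].
(* In the top layer, [(cx, cy)] is a corner of the square to split off. *)
pose cx := if M < x then M else 0; pose cy := if M < y then M else 0.
have cxP : cx = 0 /\ x <= M \/ cx = M /\ M < x by rewrite /cx; case: ltnP; auto.
have cyP : cy = 0 /\ y <= M \/ cy = M /\ M < y by rewrite /cy; case: ltnP; auto.
have [cxx cyy] : cx <= x /\ cy <= y by lia.
(* In the doubled square, a point of a horizontal side plus a point of a vertical side gives
   [(x, y)]; in higher layers, removing the corner suffices. *)
case: h {IH step} xM yM => [|h] xM yM.
  exists 1, (x - cx), cy, 1, cx, (y - cy); rewrite /= !subnK ?subnKC //.
  by split=> //; clearbody cx cy; lia.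
exists 1, cx, cy, h.+2, (x - cx), (y - cy); rewrite !subnKC //.
move: xM yM; rewrite !mulSn => xM yM; clearbody cx cy.
split=> //=; first lia.
by rewrite !mulSn; lia.
Qed.

Lemma sum_interval (a b n : nat) : \sum_(y < n) (a <= y < b : nat) = minn b n - a.
Proof. by elim: n => [|n IH]; rewrite ?big_ord0 ?big_ord_recr /= ?IH; lia. Qed.

Lemma card_iter_base_set (Q M : nat) (l : nat -> nat) (h : nat) :
  0 < h -> h * M + h < Q -> (forall x, l x + h <= M) ->
  (forall x, 0 < l x -> 0 < x < M) ->
  #|` iter_sumset h (base_set Q M l)| =
  #|` iter_sumset h (base_set Q M (fun=> 0))| + \sum_(x < Q) minn h (l x).
Proof.
move=> h0 ltQ lhM lsupp.
have MhM : M <= h * M by rewrite leq_pmull.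
have hM : h <= M by have := lhM 0; lia.
have bnd l' : (forall x, l' x <= M) -> forall g x y, cells M l' h g x y ->
    [/\ g < Q, x < Q & y < Q].
  move=> l'M g x y; have l'x := l'M x.
  case: g => [|[|g]] /=; try by move=> ?; split; lia.
  move=> /and3P [gh xg yg].
  have : g.+2 * M <= h * M by rewrite leq_mul2r gh orbT.
  by split; lia.
have lM x : l x <= M by have := lhM x; lia.
rewrite (card_encode (bnd _ lM) (fun z => iter_base_setP Q z lM h0)).
rewrite (card_encode (bnd (fun=> 0) (fun=> leq0n _))
  (fun z => iter_base_setP Q z (fun=> leq0n _) h0)).
have Q1 : 1 < Q by lia.
have -> : \sum_(x < Q) minn h (l x) =
    \sum_(g < Q) \sum_(x < Q) (g == 1 :> nat) * minn h (l x).
  rewrite [RHS](bigD1 (Ordinal Q1)) //= [X in _ + X]big1 ?addn0.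
    by apply: eq_bigr => x _; rewrite mul1n.
  move=> g; rewrite -val_eqE /= => /negPf g1.
  by apply: big1 => x _; rewrite g1.
rewrite -big_split /=; apply: eq_bigr => -[g gQ] _ /=.
rewrite -big_split /=; apply: eq_bigr => -[x xQ] _ /=.
case: g gQ => [|[|g]] gQ; rewrite ?mul0n ?addn0 //.
have [lhx lsx] := (lhM x, lsupp x).
(* Since [l x + h <= M], the interval starting at [l x] can meet only the one starting at 0, so its
   new part runs from [maxn h (l x)] to [l x + h]. *)
rewrite mul1n (_ : minn _ _ = minn (l x + h) Q - maxn h (l x)); last by lia.
rewrite -sum_interval -big_split; apply: eq_bigr => y _ /=.
by lia.
Qed.

(* Two columns of heights [k, k] against two columns of heights [k-1, k+1]: the
   second difference of [min (h, _)] at [k] is the indicator of [h = k]. *)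
Definition heights (H : nat) (eps : nat -> bool) (x : nat) : nat :=
  let k := uphalf x in
  if 0 < x <= 2 * H then (if eps k then k else if odd x then k.-1 else k.+1)
  else 0.

Lemma sum_heights (H Q : nat) (eps : nat -> bool) (h : nat) :
  2 * H < Q ->
  \sum_(x < Q) minn h (heights H eps x) =
  \sum_(k < H) (minn h k + minn h k.+2) + (eps h && (0 < h <= H)).
Proof.
move=> HQ.
pose F x := minn h (let k := uphalf x.+1 in
  if eps k then k else if odd x.+1 then k.-1 else k.+1).
have -> : \sum_(x < Q) minn h (heights H eps x) = \sum_(x < 2 * H) F x.
  rewrite -(big_mkord xpredT (fun x => minn h (heights H eps x))).
  rewrite (big_cat_nat (n := (2 * H).+1)) //= [X in _ + X]big_nat_cond.
  rewrite [X in _ + X]big1 ?addn0 => [|x /andP [/andP [Hx _] _]]; last first.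
    by rewrite /heights ifF ?minn0 //; lia.
  rewrite big_mkord big_ord_recl /heights /= minn0 add0n.
  by apply: eq_bigr => -[x /= xH] _; rewrite /F /= /bump add1n xH.
elim: H {HQ} => [|H IH]; first by rewrite muln0 !big_ord0; lia.
rewrite mulnS !big_ord_recr {}IH /= /F.
have [-> ->] : uphalf (2 * H).+1 = H.+1 /\ uphalf (2 * H).+2 = H.+1 by lia.
have -> : odd (2 * H).+1 by lia.
have -> : odd (2 * H).+2 = false by lia.
have [<-|nh] := eqVneq H.+1 h.
  case: (eps H.+1) => /=; lia.
case: (eps H.+1); case: (eps h) => /=; lia.
Qed.

Lemma all_signs_realizable_linear (H : nat) : all_signs_realizable H (10 * H + 12).
Proof.
(* This [M] leaves [2 * H] interior columns and room for heights up to [H.+1] plus [h <= H].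
   Negating the signs for the second set makes the sizes differ by exactly 1. *)
move=> eps; pose M := (2 * H).+1; pose Q := (H * M + H).+1.
pose A e := base_set Q M (heights H e).
have cardA e : #|` A e| <= 10 * H + 12.
  by apply: leq_trans (card_base_set _ _ _) _; rewrite /M; lia.
exists (A eps), (A (negb \o eps)); split=> // h /andP [h0 hH] /=.
have countA e : #|` iter_sumset h (A e)| =
    #|` iter_sumset h (base_set Q M (fun=> 0))| +
    (\sum_(k < H) (minn h k + minn h k.+2) + e h).
  rewrite (card_iter_base_set (l := heights H e)) //.
  - by rewrite sum_heights ?h0 ?hH ?andbT // /Q /M; nia.
  - by rewrite /Q ltnS; apply: leq_add => //; rewrite leq_mul2r hH orbT.
  - by move=> x; rewrite /heights /M; do 3?case: ifP; lia.
  - by move=> x; rewrite /heights /M; case: ifP; lia.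
by rewrite !countA /=; case: (eps h); lia.
Qed.
End Construction.

(** * Lower bound: counting sequences of sumset sizes *)

Lemma size_undup_map_kernel (T U V : eqType) (f : T -> U) (g : T -> V) (s : seq T) :
  (forall x y, (f x == f y) = (g x == g y)) ->
  size (undup (map f s)) = size (undup (map g s)).
Proof.
move=> fg; elim: s => //= x s IH.
suff -> : (f x \in map f s) = (g x \in map g s) by case: ifP; rewrite /= IH.
by elim: s {IH} => //= y s IH; rewrite !inE fg IH.
Qed.

Lemma spanning_rows (F : fieldType) (n k : nat) (A : 'M[F]_(n, k)) (i0 : 'I_n) :
  exists f : 'I_k -> 'I_n, (A <= rowsub f A)%MS.
Proof.
(* The rank may be less than [k]; the spare indices are padded with [i0]. *)
exists (fun i => if insub (val i) is Some j then maxrankfun A j else i0).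
rewrite -(eq_maxrowsub A); apply/row_subP => j.
rewrite row_rowsub; set B := rowsub _ A.
suff <- : row (widen_ord (rank_leq_col A) j) B = row (maxrankfun A j) A.
  exact: row_sub.
rewrite row_rowsub insubT //= => ltj; congr (row (maxrankfun A _) A).
exact: val_inj.
Qed.

Section Relations.
Variables H k : nat.

Definition box := {ffun 'I_k -> 'I_(2 * H).+1}.

Definition box_vec (w : box) : 'rV[rat]_k := \row_j ((w j)%:R - H%:R).

Definition relation (a : 'I_k -> int) (w : box) : bool :=
  box_vec w *m (\col_j (a j)%:~R) == 0.

Definition in_span (c : {ffun 'I_k -> box}) (w : box) : bool :=
  (box_vec w <= \matrix_i box_vec (c i))%MS.

Lemma relation_span (a : 'I_k -> int) :
  exists c : {ffun 'I_k -> box}, relation a =1 in_span c.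
Proof.
have ltH : (H < (2 * H).+1)%N by lia.
pose w0 : box := [ffun=> Ordinal ltH].
have vec0 : box_vec w0 = 0.
  by apply/rowP => j; rewrite !mxE ffunE subrr.
(* Sending non-relations to the zero vector makes the row space of [A] the span of all relations in
   the box. *)
pose r (w : box) := if relation a w then w else w0.
have rr w : relation a (r w).
  by rewrite /r; case: ifP => // _; rewrite /relation vec0 mul0mx.
pose A := \matrix_(i < #|{: box}|) box_vec (r (enum_val i)).
have [f Af] := spanning_rows A (enum_rank w0).
pose c : {ffun 'I_k -> box} := [ffun i => r (enum_val (f i))].
exists c => w; apply/idP/idP => [aw|].
  apply: (submx_trans (B := A)).
    have -> : box_vec w = row (enum_rank w) A.
      by rewrite rowK enum_rankK /r aw.
    exact: row_sub.
  apply: (submx_trans Af); rewrite (_ : rowsub f A = \matrix_i box_vec (c i)) //.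
  by apply/row_matrixP => i; rewrite row_rowsub !rowK ffunE.
have c0 : (\matrix_i box_vec (c i)) *m (\col_j (a j)%:~R) = 0.
  apply/row_matrixP => i; rewrite row_mul rowK row0 ffunE.
  exact/eqP/rr.
by move=> /submxP [D wD]; rewrite /relation wD -mulmxA c0 mulmx0.
Qed.

Lemma sum_map_count (a : 'I_k -> int) (s : seq 'I_k) :
  \sum_(i <- s) a i = \sum_j (count_mem j s)%:R * a j.
Proof.
elim: s => [|x s IH]; first by rewrite big_nil big1 // => j _; rewrite mul0r.
rewrite big_cons IH (bigD1 x) //= [RHS](bigD1 x) //= eqxx natrD mulrDl mul1r addrA.
by congr (_ + _); apply: eq_bigr => j /negPf; rewrite eq_sym => ->.
Qed.

(** The vector [w] is the difference of the multiplicities in [s] and [t]; it is chosen before [a],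
    so it serves all sets at once. *)
Lemma sum_eq_relation (s t : seq 'I_k) :
  (size s <= H)%N -> (size t <= H)%N ->
  exists w : box, forall a : 'I_k -> int,
    (\sum_(i <- s) a i == \sum_(i <- t) a i) = relation a w.
Proof.
move=> sH tH.
have wH j : (H + count_mem j s - count_mem j t < (2 * H).+1)%N.
  by have /leq_trans/(_ sH) := count_size (pred1 j) s; lia.
exists [ffun j => Ordinal (wH j)] => a.
rewrite /relation -subr_eq0 (sum_map_count a s) (sum_map_count a t) -sumrB.
set v := _ *m _; rewrite (_ : v = const_mx (\sum_j
   ((count_mem j s)%:R * a j - (count_mem j t)%:R * a j))%:~R); last first.
  apply/matrixP => i j; rewrite !mxE rmorph_sum /=; apply: eq_bigr => l _.
  rewrite !mxE ffunE /= -mulrBl rmorphM /=; congr (_ * _).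
  have /leq_trans/(_ tH) ltH := count_size (pred1 l) t.
  rewrite natrB; last by apply: leq_trans ltH (leq_addr _ _).
  by rewrite natrD rmorphB /= !natz; ring.
apply/eqP/eqP => [->|/matrixP /(_ ord0 ord0)].
  by apply/matrixP => i j; rewrite !mxE.
by rewrite !mxE => /eqP; rewrite intr_eq0 => /eqP.
Qed.

Lemma card_iter_image (a : 'I_k -> int) (A : {fset int}) (h : nat) :
  A =i codom a ->
  #|` iter_sumset h A| =
  size (undup [seq \sum_(i <- val s) a i | s <- enum {: h.-tuple 'I_k}]).
Proof.
move=> Aa; apply/perm_size/uniq_perm; rewrite ?undup_uniq ?fset_uniq // => z.
rewrite mem_undup; apply/iter_sumsetP/mapP => [[s [sh sA ->]]|[t _ ->]].
  have [t st] : exists t, s = map a t.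
    elim: s sA {sh} => [|x s IH] /=; first by exists [::].
    by rewrite Aa => /andP [/codomP [i ->] /IH [t ->]]; exists (i :: t).
  have th : size t == h by rewrite -sh st size_map.
  by exists (Tuple th); rewrite ?mem_enum // st big_map.
exists (map a t); rewrite size_map size_tuple big_map; split=> //.
by apply/allP => _ /mapP [i _ ->]; rewrite /= Aa codom_f.
Qed.

(** The enumeration [a] may repeat values, which covers nonempty sets with fewer than [k] elements;
    [None] codes the empty set. *)
Definition coded (o : option {ffun 'I_k -> box}) (A : {fset int}) : Prop :=
  if o is Some c then exists2 a : 'I_k -> int, A =i codom a & relation a =1 in_span c
  else A = fset0.

Lemma exists_code (A : {fset int}) : (#|` A| <= k)%N -> exists o, coded o A.
Proof.
have [-> _|[x xA] Ak] := fset_0Vmem A; first by exists None.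
pose a (i : 'I_k) := nth x (enum_fset A) i.
have [c ca] := relation_span a; exists (Some c), a => // z.
apply/idP/codomP => [zA|[i ->]].
  have iA : (index z (enum_fset A) < k)%N.
    by apply: leq_trans Ak; rewrite index_mem.
  by exists (Ordinal iA); rewrite /a /= nth_index.
rewrite /a; have [ltA|leA] := ltnP i (size (enum_fset A)); first exact: mem_nth.
by rewrite nth_default.
Qed.

Lemma coded_card (o : option {ffun 'I_k -> box}) (A A' : {fset int}) (h : nat) :
  (h <= H)%N -> coded o A -> coded o A' ->
  #|` iter_sumset h A| = #|` iter_sumset h A'|.
Proof.
case: o => [c|] hH /= => [[a Aa ac] [a' Aa' ac']|-> -> //].
rewrite (card_iter_image _ Aa) (card_iter_image _ Aa').
apply: size_undup_map_kernel => s t.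
have [||w ww] := @sum_eq_relation s t; rewrite ?size_tuple //.
by rewrite !ww ac ac'.
Qed.

(** A pair of codes fixes all sizes up to [H], hence the sign pattern, so patterns inject into pairs
    of codes. *)
Lemma sign_patterns_bound :
  all_signs_realizable H k -> (2 ^ H <= (((2 * H).+1 ^ k) ^ k).+1 ^ 2)%N.
Proof.
move=> Hk; pose eps (t : H.-tuple bool) h := nth false t h.-1.
have codes (t : H.-tuple bool) : exists o, exists A B,
    [/\ coded o.1 A, coded o.2 B & realizes_signs H (eps t) A B].
  have [A [B [/exists_code [p pA] /exists_code [q qB] AB]]] := Hk (eps t).
  by exists (p, q), A, B.
have [F FP] := choice codes.
have F_inj : injective F.
  move=> t t' Ftt'; apply/val_inj/(@eq_from_nth _ false); rewrite !size_tuple // => i iH.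
  have [A [B [pA pB /(_ i.+1)]]] := FP t.
  have [A' [B' [pA' pB' /(_ i.+1)]]] := FP t'.
  rewrite -Ftt' in pA' pB'.
  rewrite iH (coded_card iH pA pA') (coded_card iH pB pB') /eps /=.
  by move=> /(_ isT) + /(_ isT); do 2!case: nth => //; lia.
have := leq_card F F_inj.
by rewrite card_tuple card_bool card_prod card_option !card_ffun !card_ord mulnn.
Qed.
End Relations.

(** * Both bounds on [kappa] *)

Lemma kappaP (H : nat) :
  all_signs_realizable H (kappa H) /\
  forall j : nat, all_signs_realizable H j -> (kappa H <= j)%N.
Proof.
apply: (@xgetPex _ 0%N (fun k => all_signs_realizable H k /\
  forall j, all_signs_realizable H j -> (k <= j)%N)).
have ex : exists k, `[< all_signs_realizable H k >].
  by exists (10 * H + 12)%N; apply/asboolP/all_signs_realizable_linear.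
case: (ex_minnP ex) => k /asboolP Hk min_k.
by exists k; split=> // j Hj; apply/min_k/asboolP.
Qed.

Lemma sign_patterns_bound_pow (H k : nat) :
  (3 <= H)%N -> all_signs_realizable H k -> (2 ^ H <= H ^ (4 * k ^ 2))%N.
Proof.
move=> H3 /sign_patterns_bound; rewrite -expnM mulnn.
have [->|k0] := posnP k.
  by rewrite exp0n // expn0 leq_exp2l // leqNgt H3.
have m0 : (0 < k ^ 2)%N by rewrite expn_gt0 k0.
move: (k ^ 2)%N m0 => m m0 /leq_trans; apply.
(* Strictness, from [2 * H + 1 < H ^ 2] for [H >= 3], absorbs the extra 1 for the empty set. *)
have base : ((2 * H).+1 ^ m < (H ^ 2) ^ m)%N by rewrite ltn_exp2r //; nia.
have -> : (4 * m = 2 * m * 2)%N by lia.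
by rewrite !expnM leq_exp2r.
Qed.

Theorem theorem1p6 (R : realType) :
  exists c C : R, [/\ 0 < c, 0 < C &
    forall H : nat, (3 <= H)%N ->
      c * Num.sqrt (H%:R / ln (H%:R : R)) <= (kappa H)%:R <= C * H%:R].
Proof.
(* The first constant solves [H * ln 2 <= 4 * k ^ 2 * ln H] for [k]; the second comes from
   [10 * H + 12 <= 14 * H] when [H >= 3]. *)
exists (Num.sqrt (ln 2) / 2), 14.
have ln2_gt0 : 0 < ln 2 :> R by rewrite ln_gt0 // ltr1n.
split; rewrite ?divr_gt0 ?sqrtr_gt0 // => H H3.
have [Hk min_k] := kappaP H; set k := kappa H in Hk min_k *.
apply/andP; split; last first.
  rewrite -natrM ler_nat.
  by apply: leq_trans (min_k _ (all_signs_realizable_linear H)) _; lia.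
have lnH_gt0 : 0 < ln (H%:R : R) by rewrite ln_gt0 // ltr1n; lia.
have ln_le : H%:R * ln 2 <= (4 * k%:R ^+ 2) * ln (H%:R : R).
  have H0 : 0 < H%:R :> R by rewrite ltr0n; lia.
  rewrite [leLHS]mulr_natl -natrX -natrM [leRHS]mulr_natl -!lnXn //.
  rewrite ler_ln ?posrE ?exprn_gt0 // -!natrX ler_nat.
  exact: sign_patterns_bound_pow.
rewrite mulrAC -sqrtrM ?(ltW ln2_gt0) // ler_pdivrMr //.
rewrite -[leRHS]ger0_norm ?mulr_ge0 // -sqrtr_sqr ler_wsqrtr //.
rewrite mulrA ler_pdivrMr // mulrC; apply: le_trans ln_le _.
by rewrite ler_wpM2r ?(ltW lnH_gt0) // exprMn; lra.
Qed.
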